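(* Let $k,\ell$ be positive integers with $k\geq 3$. (i) If $\ell>\lfloor k/2\rfloor$, then with $N=4\left\lceil\left(\frac{k+\ell-1}{\ln(1-k!/k^{k})}\right)^{2}\right\rceil$ we have $rx_{k,\ell}(K_{n})=k$ for every integer $n\geq N$. (ii) If $\ell\leq\lfloor k/2\rfloor$, then with $N=\max\left\{4\left\lceil\left(\frac{k+\ell-1}{\ln(1-k!/k^{k})}\right)^{2}\right\rceil,\ R_{k-1}(k)\right\}$ we have $rx_{k,\ell}(K_{n})=k$ for every integer $n\geq N$.
   Context: An edge-coloring of a graph $G$ is any map $c:E(G)\to\{1,\dots,t\}$ (adjacent edges may receive the same color). A tree is rainbow if no two of its edges have the same color. For $S\subseteq V(G)$, a rainbow $S$-tree is a rainbow tree in $G$ whose vertex set contains $S$. $S$-trees $T_1,\dots,T_\ell$ are internally disjoint if $E(T_i)\cap E(T_j)=\emptyset$ and $V(T_i)\cap V(T_j)=S$ for all $i\ne j$. For $k\ge2$, $\ell\ge1$, $rx_{k,\ell}(G)$ is the minimum number of colors in an edge-coloring of $G$ such that for every $k$-subset $S\subseteq V(G)$ there exist $\ell$ internally disjoint rainbow $S$-trees. $K_n$ is the complete graph on $n$ vertices. The multicolor Ramsey number $R_{r}(t)$ is the smallest integer $n$ such that every $r$-edge-coloring of $K_n$ contains a complete subgraph on $t$ vertices all of whose edges have the same color. *)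

(* Defs.v *)
From mathcomp Require Import all_boot all_order all_algebra.
From mathcomp Require Import boolp reals exp.

Set Implicit Arguments.
Unset Strict Implicit.
Unset Printing Implicit Defensive.

Import Order.TTheory GRing.Theory Num.Theory.

(* Minimum of a set of naturals, with the conventional value 0 when the
   set is empty. *)
Definition least (P : nat -> Prop) : nat :=
  match pselect (exists n, `[< P n >]) with
  | left exP => ex_minn exP
  | right _ => 0
  end.

(* Finite simple graphs with vertices drawn from an ambient finite type, so
   that a graph and its subgraphs live in the same type; edges are 2-sets. *)
Record graph (T : finType) := Graph {
  vertices : {set T};
  edges : {set {set T}};
  edges_sub : [forall e in edges, (e \subset vertices) && (#|e| == 2)]
}.

Section GraphNotions.
Variable T : finType.
Implicit Types (G H : graph T) (A S : {set T}) (c : {set T} -> nat).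

Definition subgraph H G : bool :=
  (vertices H \subset vertices G) && (edges H \subset edges G).

Definition adj H : rel T := fun x y => [set x; y] \in edges H.

Definition connected H : Prop :=
  0 < #|vertices H| /\ {in vertices H &, forall x y, connect (adj H) x y}.

(* An edge traversed back and forth is a duplicate-free cyclic sequence of
   size 2; genuine cycles have size at least 3. *)
Definition acyclic H : Prop := forall s : seq T, ucycle (adj H) s -> size s <= 2.

Definition tree H : Prop := connected H /\ acyclic H.

(* Colourings are total functions on 2-sets; only the values on the edges of
   the graph at hand are constrained or used. *)
Definition edge_coloring G (t : nat) c : Prop :=
  {in edges G, forall e, 1 <= c e <= t}.

Definition rainbow c H : Prop := {in edges H &, injective c}.

Definition monochromatic c H : Prop := {in edges H &, forall e f, c e = c f}.

Definition rainbow_Stree G c S H : Prop :=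
  [/\ subgraph H G, tree H, rainbow c H & S \subset vertices H].

Definition internally_disjoint S (l : nat) (F : 'I_l -> graph T) : Prop :=
  forall i j : 'I_l, i <> j ->
    [disjoint edges (F i) & edges (F j)] /\
    vertices (F i) :&: vertices (F j) = S.

Definition rx_coloring (k l : nat) G c : Prop :=
  forall S, S \subset vertices G -> #|S| = k ->
    exists F : 'I_l -> graph T,
      (forall i, rainbow_Stree G c S (F i)) /\ internally_disjoint S F.

Definition rx (k l : nat) G : nat :=
  least (fun t => exists c, edge_coloring G t c /\ rx_coloring k l G c).

Fact complete_subproof A :
  [forall e in [set e : {set T} | (e \subset A) && (#|e| == 2)],
     (e \subset A) && (#|e| == 2)].
Proof. by apply/forall_inP => e; rewrite inE. Qed.

Definition complete A : graph T := Graph (complete_subproof A).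

End GraphNotions.

Definition K (n : nat) : graph 'I_n := complete [set: 'I_n].

Definition ramsey (r t : nat) : nat :=
  least (fun n => forall c, edge_coloring (K n) r c ->
    exists A : {set 'I_n}, #|A| = t /\ monochromatic c (complete A)).

Local Open Scope ring_scope.

Definition threshold (R : realType) (k l : nat) : int :=
  4 * Num.ceil (((k%:R + l%:R - 1) / ln (1 - k`!%:R / k%:R ^+ k)) ^+ 2 : R).

(* Main.v *)
(* Upper bound: colour the edges of K_n with k colours at random. A star centred
   outside a k-set S is rainbow with probability p = k!/k^k, stars with different
   centres are independent and internally disjoint, and the union bound over S and
   over the at most l - 1 centres of rainbow stars leaves a failure probability of
   at most n^(k+l-1) (1-p)^(n-k-l+1), which is less than 1 above the threshold.
   Lower bound: with at most k - 1 colours a rainbow S-tree has at most k - 1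
   edges, hence spans exactly S. Then l edge-disjoint ones need l(k-1) <= C(k,2),
   which fails if l > k/2, and a monochromatic S admits none at all. *)
Require Import Defs.
From mathcomp Require Import all_boot all_order all_algebra.
From mathcomp Require Import boolp reals exp.
From mathcomp Require Import zify ring lra.

Set Implicit Arguments.
Unset Strict Implicit.
Unset Printing Implicit Defensive.

Import Order.TTheory GRing.Theory Num.Theory.

(** * Minima of sets of natural numbers *)

Lemma leastP (P : nat -> Prop) : (exists n, P n) -> P (least P).
Proof.
move=> [n Pn]; rewrite /least; case: pselect => [exP|[]].
  by case: ex_minnP => m /asboolP.
by exists n; apply/asboolP.
Qed.

Lemma least_eq (P : nat -> Prop) (m : nat) :
  P m -> (forall t, t < m -> ~ P t) -> least P = m.
Proof.
move=> Pm Pmin; rewrite /least; case: pselect => [exP|[]]; last first.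
  by exists m; apply/asboolP.
case: ex_minnP => p /asboolP Pp minp.
have := minp m; rewrite asboolT // => /(_ isT) le_pm.
by case: (ltnP p m) => [/Pmin //|le_mp]; apply/eqP; rewrite eqn_leq le_pm.
Qed.

(** * Edge counts of connected graphs and of rainbow trees *)

Section Graphs.
Variable T : finType.
Implicit Types (G H : graph T) (A B S : {set T}) (c : {set T} -> nat).

Lemma edgesP H e : e \in edges H -> (e \subset vertices H) /\ #|e| = 2.
Proof. by move=> eH; have /forall_inP/(_ e eH)/andP[? /eqP] := edges_sub H. Qed.

Lemma edge_vertices H x y :
  adj H x y -> [/\ x \in vertices H, y \in vertices H & x != y].
Proof.
move=> /edgesP[/subsetP sub]; rewrite cards2 => cxy.
by split; [apply: sub; rewrite set21|apply: sub; rewrite set22|case: eqP cxy].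
Qed.

Lemma adj_sym H : symmetric (adj H).
Proof. by move=> x y; rewrite /adj setUC. Qed.

(** If no edge left [A], then [A] would be closed under adjacency, hence a union of components. *)
Lemma crossing_edge H A x y :
  connect (adj H) x y -> x \in A -> y \notin A ->
  exists u v, [/\ adj H u v, u \in A & v \notin A].
Proof.
move=> cxy xA yNA; apply: contrapT => none.
have clA : closed (adj H) A.
  apply: intro_closed => [|u v uv uA].
    by apply: sym_connect_sym; apply: adj_sym.
  by apply: contrapT => /negP vNA; apply: none; exists u, v.
by move: yNA; rewrite -(closed_connect clA cxy) xA.
Qed.

(* Grow a set of vertices from one vertex, recording a new edge at each step. *)
Lemma connected_card_vertices H : connected H -> #|vertices H| <= #|edges H|.+1.
Proof.
move=> [/card_gt0P[r rH] conn].
have grow j : j < #|vertices H| ->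
  exists A (E : {set {set T}}),
    [/\ r \in A, A \subset vertices H, #|A| = j.+1, E \subset edges H &
        #|E| = j /\ {in E, forall e : {set T}, e \subset A}].
  elim: j => [_|j IHj ltj].
    exists [set r], set0; split; rewrite ?set11 ?sub1set ?cards1 ?sub0set //.
    by rewrite cards0; split=> // e; rewrite inE.
  have [A [E [rA AV cA EH [cE EA]]]] := IHj (ltnW ltj).
  have [y yH yNA] : exists2 y, y \in vertices H & y \notin A.
    apply/subsetPn; apply/negP => /subset_leq_card; rewrite cA leqNgt.
    by rewrite ltj.
  have [u [v [uv uA vNA]]] := crossing_edge (conn _ _ rH yH) rA yNA.
  have [_ vH _] := edge_vertices uv.
  exists (v |: A), ([set u; v] |: E); split.
  - by rewrite inE rA orbT.
  - by rewrite subUset sub1set vH.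
  - by rewrite cardsU1 vNA cA.
  - by rewrite subUset sub1set EH andbT.
  split=> [|e /setU1P[->|/EA eA]].
  - rewrite cardsU1 cE; case: (boolP (_ \in E)) => //= /EA /subsetP /(_ v).
    by rewrite set22 (negPf vNA) => /(_ isT).
  - by rewrite subUset !sub1set !inE uA eqxx orbT.
  - exact: subset_trans eA (subsetUr _ _).
have : #|vertices H|.-1 < #|vertices H|.
  by rewrite prednK // (cardD1 r) rH.
case/grow => A [E [_ _ _ /subset_leq_card EH [cE _]]].
by move: EH; rewrite cE; case: #|vertices H|.
Qed.

Lemma rainbow_card_edges G t c H :
  edge_coloring G t c -> subgraph H G -> rainbow c H -> #|edges H| <= t.
Proof.
move=> cG /andP[_ /subsetP HG] rb.
rewrite cardE -(size_map c) -[leqRHS](size_iota 1).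
apply: uniq_leq_size.
  rewrite map_inj_in_uniq ?enum_uniq // => e f.
  by rewrite !mem_enum; apply: rb.
move=> _ /mapP[e + ->]; rewrite mem_enum => /HG /cG.
by rewrite mem_iota add1n ltnS.
Qed.

(* With fewer colours than vertices in S a rainbow S-tree has no room outside S. *)
Lemma rainbow_Stree_spanning G t c S H :
  edge_coloring G t c -> t < #|S| -> rainbow_Stree G c S H ->
  vertices H = S /\ #|S| <= #|edges H|.+1.
Proof.
move=> cG ltS [HG [conn _] rb SH].
have cV := connected_card_vertices conn.
have cE := rainbow_card_edges cG HG rb.
have VS : S = vertices H.
  by apply/eqP; rewrite eqEcard SH; apply: leq_trans cV _; apply: leq_trans ltS.
by split; rewrite ?VS.
Qed.

(** Each tree spans exactly [S], so it uses at least [#|S| - 1] of the 2-subsets of [S], and no two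
    trees share one. *)
Lemma disjoint_Strees_card G t c S l (F : 'I_l -> graph T) :
  edge_coloring G t c -> t < #|S| ->
  (forall i, rainbow_Stree G c S (F i)) -> internally_disjoint S F ->
  l * #|S|.-1 <= 'C(#|S|, 2).
Proof.
move=> cG ltS rbF disj.
rewrite -cards_draws -[l in l * _]card_ord -sum_nat_const.
apply: (@leq_trans #|\bigcup_i edges (F i)|).
  rewrite -[#|\bigcup_i _|]sum1_card partition_disjoint_bigcup; last first.
    by move=> i j /eqP ij; case: (disj i j ij).
  apply: leq_sum => i _; rewrite sum1_card.
  by have [_] := rainbow_Stree_spanning cG ltS (rbF i); case: #|S|.
apply/subset_leq_card/bigcupsP => i _; apply/subsetP => e /edgesP[eV ce].
have [VS _] := rainbow_Stree_spanning cG ltS (rbF i).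
by rewrite inE ce -VS eV.
Qed.

(** The tree would span exactly [S] with at least two edges, all inside [S] and so of one colour. *)
Lemma mono_not_rainbow G t c S H :
  edge_coloring G t c -> t < #|S| -> 2 < #|S| ->
  monochromatic c (complete S) -> ~ rainbow_Stree G c S H.
Proof.
move=> cG ltS S3 mono rbH; have [VS cE] := rainbow_Stree_spanning cG ltS rbH.
have [_ _ rb _] := rbH.
have : 1 < #|edges H| by rewrite -ltnS (leq_trans S3).
case/card_gt1P => e [f [eH fH /eqP]]; apply; apply: rb => //.
apply: mono; rewrite inE -VS.
  by have [-> ->] := edgesP eH.
by have [-> ->] := edgesP fH.
Qed.

(** * Stars *)

Definition star_edges (v : T) S : {set {set T}} := [set [set v; s] | s in S].

Lemma star_subproof v S :
  [forall e in star_edges v (S :\ v), (e \subset v |: S) && (#|e| == 2)].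
Proof.
apply/forall_inP => _ /imsetP[s /setD1P[sv sS] ->].
by rewrite subUset !sub1set !inE eqxx sS orbT cards2 (eq_sym v s) sv.
Qed.

(** Deleting [v] from the leaves keeps this a graph for every [v]; for centres outside [S],
    [setD1_notin] undoes the deletion. *)
Definition star v S : graph T := Graph (star_subproof v S).

Lemma star_adj v S x y :
  adj (star v S) x y -> (x == v) || (y == v).
Proof.
move=> /imsetP[s _ E]; have : v \in [set x; y] by rewrite E set21.
by rewrite !inE ![v == _]eq_sym.
Qed.

Lemma star_connected v S : connected (star v S).
Proof.
split; first by apply/card_gt0P; exists v; rewrite setU11.
have cv x : x \in vertices (star v S) -> connect (adj (star v S)) v x.
  rewrite !inE; case: eqP => [-> _|/eqP xv /= xS]; first exact: connect0.
  by apply/connect1/imsetP; exists x; rewrite // !inE xv.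
move=> x y xV yV; apply: connect_trans (cv y yV).
by rewrite (sym_connect_sym (@adj_sym _)) cv.
Qed.

(** Every edge contains the centre. On a cycle [x, y, z, ...] the first two edges force [y] to be
    the centre, and the closing edge at [x] then makes [y] occur a second time. *)
Lemma star_acyclic v S : acyclic (star v S).
Proof.
move=> [|x [|y [|z s]]] // /andP[] /=.
rewrite rcons_path !inE !negb_or => /and4P[/star_adj xy /star_adj yz _ lx].
case/and4P=> /and3P[xNy xNz xNs] /andP[yNz yNs] _ _.
case/orP: xy => /eqP xv.
  by move: yz; rewrite -xv ![_ == x]eq_sym (negPf xNy) (negPf xNz).
move: (star_adj lx); rewrite -xv (negPf xNy) orbF => /eqP E.
have := mem_last z s; rewrite E inE (negPf yNz) /= => ys.
by rewrite ys in yNs.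
Qed.

(** The centre is recovered as the endpoint outside [S]. This yields both the disjointness of stars
    and the count of their edges. *)
Lemma star_edge_inj v w s s' S :
  v \notin S -> w \notin S -> s \in S -> s' \in S ->
  [set v; s] = [set w; s'] -> v = w /\ s = s'.
Proof.
move=> vS wS sS s'S E.
have /set2P[vw|vs] : v \in [set w; s'] by rewrite -E set21.
  have /set2P[sw|ss] : s \in [set w; s'] by rewrite -E set22.
    by rewrite -sw sS in wS.
  by split.
by rewrite vs s'S in vS.
Qed.

Lemma setD1_notin v S : v \notin S -> S :\ v = S.
Proof. by move=> vS; apply/setDidPl; rewrite disjoint_sym disjoints1. Qed.

Lemma star_rainbow c v S : v \notin S ->
  {in S &, injective (fun s => c [set v; s])} -> rainbow c (star v S).
Proof.
move=> vS inj _ _ /imsetP[s + ->] /imsetP[s' + ->].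
by rewrite setD1_notin // => sS s'S /(inj _ _ sS s'S) ->.
Qed.

Lemma stars_disjoint v w S : v \notin S -> w \notin S -> v <> w ->
  [disjoint edges (star v S) & edges (star w S)] /\
  vertices (star v S) :&: vertices (star w S) = S.
Proof.
move=> vS wS vw; split.
  apply/pred0P => e /=; apply/negP => /andP[/imsetP[s + ->] /imsetP[s']].
  rewrite !setD1_notin // => sS s'S /(star_edge_inj vS wS sS s'S) [].
  by move=> /vw.
apply/setP => x; rewrite !inE; case: (boolP (x \in S)) => xS; rewrite ?orbT //.
by rewrite !orbF; apply/negP => /andP[/eqP -> /eqP].
Qed.

End Graphs.

(** * Finiteness and monotonicity for multicolour Ramsey numbers *)

Fixpoint ramsey_bound (r m : nat) : nat :=
  if m is m'.+1 then (r * ramsey_bound r m').+2 else 0.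

(* Bounding only the total size of the sought cliques keeps the induction
   uniform in the colour whose clique shrinks. *)
Lemma ramsey_cliques (r m : nat) (s : 'I_r -> nat) (T : finType) (A : {set T})
    (c : {set T} -> 'I_r) :
  0 < r -> \sum_i s i <= m -> ramsey_bound r m <= #|A| ->
  exists (i : 'I_r) (B : {set T}), [/\ B \subset A, #|B| = s i &
    {in B &, forall x y, x != y -> c [set x; y] = i}].
Proof.
move=> r_gt0; elim: m s A => [|m IHm] s A.
  rewrite leqn0 sum_nat_eq0 => /forall_inP s0 _.
  exists (Ordinal r_gt0), set0.
  by rewrite sub0set cards0 (eqP (s0 _ isT)); split=> // x y; rewrite inE.
move=> sm bA; case: (pselect (exists i, s i = 0)) => [[i si]|s_gt0].
  by exists i, set0; rewrite sub0set cards0 si; split=> // x y; rewrite inE.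
have [v vA] : exists v, v \in A by apply/card_gt0P; apply: leq_trans bA.
pose N i := [set y in A :\ v | c [set v; y] == i].
(* Pigeonhole over the [r] colours at [v]. Of the two extra units in [ramsey_bound], one pays for
   [v] and one makes the inequality strict. *)
have [i Ni] : exists i, ramsey_bound r m < #|N i|.
  apply: contrapT => none.
  have : #|A :\ v| <= \sum_(i < r) ramsey_bound r m.
    rewrite -sum1_card (partition_big (fun y => c [set v; y]) xpredT) //=.
    apply: leq_sum => i _; rewrite sum1dep_card leqNgt; apply/negP => lt.
    by apply: none; exists i; rewrite /N cardsE; rewrite cardsE in lt.
  rewrite sum_nat_const card_ord; apply/negP; rewrite -ltnNge.
  by move: bA; rewrite (cardsD1 v) vA add1n ltnS.
have si_gt0 : 0 < s i by rewrite lt0n; apply/eqP => si; apply: s_gt0; exists i.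
(* Inside [N i] a clique of colour [i] may be one vertex short, since [v] extends it; a clique of
   another colour already has full size. *)
pose s' j := if j == i then (s i).-1 else s j.
have [|j [B [BN cB monoB]]] := IHm s' (N i) _ (ltnW Ni).
  move: sm; rewrite (bigD1 i) //= (bigD1 (F := s') i) //= {1}/s' eqxx.
  rewrite -[s i]prednK //= addSn ltnS => sm; apply: leq_trans sm.
  rewrite leq_add2l; apply: leq_sum => j ji.
  by rewrite /s' (negPf ji).
have NA : N i \subset A.
  by apply/subsetP => y; rewrite !inE -andbA => /and3P[].
exists j; have [ji|ji] := eqVneq j i; last first.
  exists B; split=> //; first exact: subset_trans NA.
  by rewrite cB /s' (negPf ji).
have BP y : y \in B -> (y != v) && (c [set v; y] == i).
  by move=> /(subsetP BN); rewrite !inE => /andP[/andP[-> _] ->].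
exists (v |: B); split.
- by rewrite subUset sub1set vA (subset_trans BN).
- have vB : v \notin B by apply/negP => /BP; rewrite eqxx.
  by rewrite cardsU1 vB cB /s' ji eqxx add1n prednK.
move=> x y /setU1P[->|xB] /setU1P[->|yB] xy; rewrite ?eqxx // in xy *.
- by have /andP[_ /eqP ->] := BP _ yB.
- by have /andP[_ /eqP] := BP _ xB; rewrite setUC ji.
- exact: monoB.
Qed.

Definition ramsey_prop r t n := forall c, edge_coloring (K n) r c ->
  exists A : {set 'I_n}, #|A| = t /\ monochromatic c (complete A).

Lemma K_edge n (e : {set 'I_n}) : (e \in edges (K n)) = (#|e| == 2).
Proof. by rewrite inE subsetT. Qed.

Lemma ramsey_prop_ex r t : 0 < r -> exists n, ramsey_prop r t n.
Proof.
case: r => // r _; exists (ramsey_bound r.+1 (\sum_(i < r.+1) t)) => c cK.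
(* Edge colours start at 1 and ordinals at 0, hence the predecessor. *)
pose d (e : {set 'I_(ramsey_bound r.+1 (\sum_(i < r.+1) t))}) : 'I_r.+1 :=
  inord (c e).-1.
have [| i [B [_ cB mB]]] :=
    ramsey_cliques (A := setT) d (ltn0Sn r) (leqnn (\sum_(i < r.+1) t)).
  by rewrite cardsT card_ord.
have colB e : e \in edges (complete B) -> c e = i.+1.
  rewrite inE => /andP[eB /cards2P[x [y [xy Exy]]]]; rewrite Exy in eB *.
  have de : d [set x; y] = i.
    by apply: mB xy; apply: (subsetP eB); rewrite ?set21 ?set22.
  have /andP[c1 c2] : 1 <= c [set x; y] <= r.+1.
    by apply: cK; rewrite K_edge cards2 xy.
  rewrite -de /d inordK prednK //.
by exists B; split=> // e f /colB -> /colB ->.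
Qed.

(** Pull the colouring back along the inclusion of ordinals and push the clique forward. *)
Lemma ramsey_prop_mono r t m n : m <= n -> ramsey_prop r t m -> ramsey_prop r t n.
Proof.
move=> le_mn Pm c cK; pose w := widen_ord le_mn.
have winj : injective w by move=> x y /(congr1 val) /= /val_inj.
have [e|A [cA mA]] := Pm (fun e => c (w @: e)).
  by rewrite K_edge => ce; apply: cK; rewrite K_edge card_imset.
exists (w @: A); split; first by rewrite card_imset.
have pre e : e \in edges (complete (w @: A)) ->
    exists2 e', e' \in edges (complete A) & e = w @: e'.
  rewrite inE => /andP[eA ce]; exists (w @^-1: e).
    rewrite inE -(card_imset _ winj).
    have -> : w @: (w @^-1: e) = e.
      apply/setP => x; apply/imsetP/idP => [[y + ->]|xe]; first by rewrite inE.
      by have /imsetP[y _ xy] := subsetP eA x xe; exists y; rewrite // inE -xy.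
    rewrite ce andbT; apply/subsetP => x; rewrite inE => /(subsetP eA).
    by case/imsetP => y yA /winj ->.
  apply/setP => x; apply/idP/imsetP => [xe|[y + ->]]; last by rewrite inE.
  by have /imsetP[y _ xy] := subsetP eA x xe; exists y; rewrite // inE -xy.
by move=> e f /pre[e' e'A ->] /pre[f' f'A ->]; apply: mA.
Qed.

(** Existence ensures that [ramsey r t] is a true minimum and not the default 0 of [least]. *)
Lemma ramsey_prop_ge r t n : 0 < r -> ramsey r t <= n -> ramsey_prop r t n.
Proof.
move=> r_gt0 le_n; apply: ramsey_prop_mono le_n _.
exact: leastP (ramsey_prop_ex t r_gt0).
Qed.

(** * The numerical estimate behind the threshold *)

Lemma fact_le_half_exp k : 2 < k -> 2 * k`! <= k ^ k.
Proof.
have aux j : 2 * (j.+1)`! <= j.+2 ^ j.+1.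
  elim: j => // j IH; rewrite factS mulnCA expnS.
  apply: leq_mul => //; apply: leq_trans IH _.
  by rewrite leq_exp2r.
case: k => [|[|k]] // _; rewrite factS mulnCA expnS leq_mul2l /=; exact: aux.
Qed.

Section Threshold.
Local Open Scope ring_scope.

(* Writing m = k + l - 1, L = - ln (1 - p) and s = sqrt n, the hypothesis says
   L s >= 2 m, so that m ln n = 2 m ln s <= 2 m (s - 1) < L (n - m). *)
Lemma exp_bound (R : realType) (p : R) (m n : nat) :
  0 < p -> p <= 2^-1 -> (0 < m)%N ->
  4 * (m%:R / ln (1 - p)) ^+ 2 <= n%:R ->
  (m <= n)%N /\ n%:R ^+ m * (1 - p) ^+ (n - m) < 1.
Proof.
move=> p0 p2 m0 hn.
have q0 : 0 < 1 - p by lra.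
pose L := - ln (1 - p).
(* From [p <= 1/2]: [L = ln (1/(1-p)) <= 1/(1-p) - 1 <= 1]. *)
have L1 : L <= 1.
  have -> : L = ln (1 + ((1 - p)^-1 - 1)).
    by rewrite addrC subrK lnV // posrE.
  have q2 : (1 - p)^-1 <= 2 by rewrite invf_ple ?posrE //; lra.
  apply: le_trans (le_ln1Dx _) _; last by lra.
  have : 0 < (1 - p)^-1 by rewrite invr_gt0.
  lra.
have L0 : 0 < L.
  rewrite oppr_gt0; have := @le_ln1Dx R (- p); lra.
have m1 : 1 <= m%:R :> R by rewrite ler1n.
pose s : R := Num.sqrt n%:R.
have s0 : 0 <= s by apply: sqrtr_ge0.
have s2 : s ^+ 2 = n%:R by rewrite sqr_sqrtr.
have lnE : ln (1 - p) = - L by rewrite opprK.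
have sm : 2 * m%:R <= L * s.
  rewrite lnE in hn.
  have : (2 * m%:R) ^+ 2 <= (L * s) ^+ 2.
    have -> : (2 * m%:R) ^+ 2 = 4 * (m%:R / - L) ^+ 2 * L ^+ 2 :> R.
      by field; rewrite gt_eqF.
    by rewrite [(L * s) ^+ 2]exprMn s2 [leRHS]mulrC ler_wpM2r // sqr_ge0.
  by rewrite ler_pXn2r // nnegrE mulr_ge0 // ltW.
have sm' : 2 * m%:R <= s by apply: le_trans sm _; rewrite ler_piMl.
have mn : (m <= n)%N.
  rewrite -(ler_nat R) -s2 expr2; apply: (@le_trans _ _ s); first by lra.
  by rewrite ler_peMl //; lra.
have n0 : 0 < n%:R :> R by rewrite ltr0n (leq_trans m0).
split=> //; rewrite -ltr_ln ?posrE ?mulr_gt0 ?exprn_gt0 // ln1.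
rewrite lnM ?posrE ?exprn_gt0 // !lnXn // lnE -s2 lnXn; last by lra.
rewrite -(mulr_natr _ m) -(mulr_natr (ln s)) -(mulr_natr (- L)).
rewrite natrB // -s2.
(* The bounds [2 m ln s <= 2 m (s - 1)], [2 m s <= L s^2] and [L m <= m] add up to a logarithm of at
   most [-m], which is negative. *)
have lns : ln s <= s - 1.
  by have := @le_ln1Dx R (s - 1); rewrite [1 + _]addrC subrK; apply; lra.
have lns' : ln s * 2 * m%:R <= (s - 1) * 2 * m%:R.
  by rewrite -!mulrA ler_wpM2r //; lra.
have Ls : 2 * m%:R * s <= L * s * s by rewrite ler_wpM2r.
have Lm : L * m%:R <= m%:R by rewrite ler_piMl //; lra.
lra.
Qed.

(** This is [exp_bound] for [p = k!/k^k], with denominators cleared so that it can be compared with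
    cardinalities. *)
Lemma threshold_bound (R : realType) (k l n : nat) :
  (2 < k)%N -> (0 < l)%N -> threshold R k l <= n%:Z ->
  (k + l.-1 <= n /\
   n ^ (k + l.-1) * (k ^ k - k`!) ^ (n - (k + l.-1)) <
     (k ^ k) ^ (n - (k + l.-1)))%N.
Proof.
move=> hk hl hn; set m := (k + l.-1)%N.
have kk0 : 0 < (k ^ k)%N%:R :> R by rewrite ltr0n expn_gt0; case: (k) hk.
have f2 := fact_le_half_exp hk.
have [||||le_mn lt1] := @exp_bound R (k`!%:R / (k ^ k)%N%:R) m n.
- by rewrite divr_gt0 // ltr0n fact_gt0.
- rewrite ler_pdivrMr // mulrC ler_pdivlMr // -natrM ler_nat mulnC //.
- by rewrite /m; case: (k) hk.
- move: hn; rewrite -(ler_int R) => /(le_trans _); apply.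
  rewrite /threshold intrM ler_wpM2l //.
  apply: le_trans (ceil_ge _); rewrite natrX.
  suff -> : k%:R + l%:R - 1 = m%:R :> R by [].
  by rewrite /m natrD -{1}(prednK hl) -natr1 addrA addrK.
split=> //; rewrite -(ltr_nat R) natrM !natrX.
have E : 1 - k`!%:R / (k ^ k)%N%:R = (k ^ k - k`!)%N%:R / (k ^ k)%N%:R :> R.
  rewrite natrB; last by apply: leq_trans f2; rewrite leq_pmull.
  by rewrite mulrBl divff // gt_eqF.
move: lt1; rewrite E expr_div_n mulrA ltr_pdivrMr ?exprn_gt0 // mul1r.
by rewrite natrX.
Qed.

End Threshold.

(** * Counting colourings and the union bound *)

Lemma bin_leq_exp n m : 'C(n, m) <= n ^ m.
Proof.
rewrite -[leqLHS]muln1 (leq_trans (leq_mul (leqnn _) (fact_gt0 m))) //.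
rewrite bin_ffact; elim: m n => // m IHm n.
rewrite ffactnS expnS leq_mul2l; apply/orP; right.
apply: leq_trans (IHm _) _; case: m {IHm} => // m.
by rewrite leq_exp2r // leq_pred.
Qed.

Lemma subset_of_card (T : finType) (A : {set T}) d :
  d <= #|A| -> exists2 D : {set T}, D \subset A & #|D| = d.
Proof.
move=> dA; exists [set x in take d (enum A)].
  by apply/subsetP => x; rewrite inE => /mem_take; rewrite mem_enum.
rewrite cardsE (card_uniqP _) ?take_uniq ?enum_uniq //.
by rewrite size_takel // -cardE.
Qed.

(** Union bound in cross-multiplied form, with [b / a] bounding the size of each set. *)
Lemma card_bigcup_bound (I T : finType) (P : {set I}) (F : I -> {set T}) a b :
  (forall i, i \in P -> #|F i| * a <= b) ->
  #|\bigcup_(i in P) F i| * a <= #|P| * b.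
Proof.
move=> hF; rewrite -[leqRHS]sum_nat_const.
elim/big_rec2: _ => [|i m A iP leA]; first by rewrite cards0.
apply: leq_trans (leq_add (hF i iP) leA).
by rewrite -mulnDl leq_mul2r leq_card_setU orbT.
Qed.

Section Counting.
Variables (T C : finType) (c0 : C).
Implicit Types (S D : {set T}) (f : {ffun {set T} -> C}).

(** Indexing by ordinals turns a rainbow star into an injective finite function, which a falling
    factorial counts. *)
Definition spokes S f (v : T) : {ffun 'I_#|S| -> C} :=
  [ffun j => f [set v; enum_val j]].

Definition nonrainbow_stars S D :=
  [set f | [forall v in D, ~~ injectiveb (spokes S f v)]].

Lemma spokesE S f v s (sS : s \in S) :
  spokes S f v (enum_rank_in sS s) = f [set v; s].
Proof. by rewrite ffunE enum_rankK_in. Qed.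

(* The spokes at the centres in D are disjoint sets of edges, so a colouring is
   recovered from its spokes at D and from its values on the other edges. *)
Lemma card_nonrainbow_stars S D : D \subset ~: S ->
  #|nonrainbow_stars S D| * (#|C| ^ #|S|) ^ #|D| <=
    (#|C| ^ #|S| - #|C| ^_ #|S|) ^ #|D| * #|C| ^ #|{set T}|.
Proof.
move=> DS.
pose Non := [set g : {ffun 'I_#|S| -> C} | ~~ injectiveb g].
have cNon : #|Non| = #|C| ^ #|S| - #|C| ^_ #|S|.
  have := cardsC [set g : {ffun 'I_#|S| -> C} | injectiveb g].
  rewrite card_inj_ffuns card_ffun !card_ord => <-.
  by rewrite addKn; apply: eq_card => g; rewrite !inE.
pose E := [set [set p.1; p.2] | p in setX D S].
have DNS v : v \in D -> v \notin S by move=> /(subsetP DS); rewrite inE.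
have cE : #|E| = #|D| * #|S|.
  rewrite -cardsX card_in_imset // => -[v s] [w s'].
  move=> /setXP[/= vD sS] /setXP[/= wD s'S].
  by case/(star_edge_inj (DNS _ vD) (DNS _ wD) sS s'S) => -> ->.
pose y0 : {ffun 'I_#|S| -> C} := [ffun=> c0].
(* The defaults [y0] off [D] and [c0] on [E] put both components into spaces [pffun_on] of known
   cardinality. *)
pose phi f := ([ffun v => if v \in D then spokes S f v else y0],
               [ffun e => if e \in E then c0 else f e]).
pose Im := setX [set G | G \in pffun_on y0 [in D] [in Non]]
                [set h : {ffun {set T} -> C} | h \in pffun_on c0 [in ~: E] predT].
have cIm : #|Im| = #|Non| ^ #|D| * #|C| ^ #|~: E|.
  by rewrite cardsX ![in LHS]cardsE !card_pffun_on.
have phi_inj : injective phi.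
  move=> f g [] /ffunP fg1 /ffunP fg2; apply/ffunP => e.
  have [/imsetP[[v s] /setXP[/= vD sS] ->]|eE] := boolP (e \in E).
    by have := fg1 v; rewrite !ffunE vD -!(spokesE _ v sS) => ->.
  by have := fg2 e; rewrite !ffunE (negPf eE).
have phiIm : phi @: nonrainbow_stars S D \subset Im.
  apply/subsetP => _ /imsetP[f + ->]; rewrite inE => /forall_inP fD.
  rewrite inE /= !inE; apply/andP; split; apply/pffun_onP; split.
  - by apply/subsetP => v; rewrite inE ffunE; case: ifP => //; rewrite eqxx.
  - move=> _ /imageP[v vD ->]; rewrite inE ffunE.
    by rewrite (vD : v \in D) fD.
  - apply/subsetP => e; rewrite inE ffunE inE.
    by case: ifP => //; rewrite eqxx.
  - by [].
(* Split [#|{set T}|] into [#|E| = #|D| * #|S|] and the rest; the factor coming from [E] then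
   cancels. *)
have := subset_leq_card phiIm; rewrite card_imset // cIm cNon => le.
rewrite -(cardsC E) expnD -expnM cE [#|S| * _]mulnC mulnA mulnAC.
by rewrite leq_mul2r le orbT.
Qed.

(** Otherwise each colouring has a set [S] with at most [l - 1] rainbow centres, leaving [d] centres
    outside [S] without a rainbow star. Counting over all pairs of [S] and such a [D] contradicts
    the numerical hypothesis. *)
Lemma exists_rainbow_stars (k l : nat) :
  #|C| = k -> 0 < l -> k + l.-1 <= #|T| ->
  #|T| ^ (k + l.-1) * (k ^ k - k`!) ^ (#|T| - (k + l.-1)) <
    (k ^ k) ^ (#|T| - (k + l.-1)) ->
  exists f, forall S, #|S| = k ->
    l <= #|[set v in ~: S | injectiveb (spokes S f v)]|.
Proof.
move=> cC l0 le_n; set d := #|T| - _ => lt.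
apply: contrapT => none.
pose draws (A : {set T}) (j : nat) := [set B : {set T} | B \subset A & #|B| == j].
have cover : [set: {ffun {set T} -> C}] \subset
    \bigcup_(S in draws setT k)
      \bigcup_(D in draws (~: S) d) nonrainbow_stars S D.
  apply/subsetP => f _; apply: contrapT => /negP/bigcupP fN.
  apply: none; exists f => S cS; rewrite leqNgt; apply/negP => few.
  set A := [set v in _ | _] in few.
  have cSC : #|~: S| = #|T| - k by rewrite -cS -(cardsC S) addKn.
  have [|D DA cD] := @subset_of_card _ (~: S :\: A) d.
    rewrite cardsDS; last by apply/subsetP => v; rewrite inE => /andP[].
    by rewrite cSC /d; move: few; lia.
  apply: fN; exists S; first by rewrite inE subsetT cS eqxx.
  apply/bigcupP; exists D.
    by rewrite inE cD eqxx andbT (subset_trans DA) // subsetDl.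
  rewrite inE; apply/forall_inP => v /(subsetP DA).
  by rewrite !inE negb_and; case: (v \in S); rewrite /= ?andbT.
have bound : #|\bigcup_(S in draws setT k)
      \bigcup_(D in draws (~: S) d) nonrainbow_stars S D| * (k ^ k) ^ d <=
    #|T| ^ (k + l.-1) * ((k ^ k - k`!) ^ d * k ^ #|{set T}|).
  rewrite expnD -mulnA.
  have cdT : #|draws setT k| <= #|T| ^ k.
    by rewrite cards_draws cardsT bin_leq_exp.
  apply: leq_trans (leq_mul cdT (leqnn _)).
  apply: card_bigcup_bound => S; rewrite inE => /andP[_ /eqP cS].
  (* By symmetry of binomials, choosing [D] amounts to choosing the [l - 1] centres left out. *)
  have cdS : #|draws (~: S) d| <= #|T| ^ l.-1.
    have cSC : #|~: S| = #|T| - k by rewrite -cS -(cardsC S) addKn.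
    rewrite cards_draws cSC -bin_sub; last by rewrite /d; lia.
    have -> : #|T| - k - d = l.-1 by rewrite /d; lia.
    apply: leq_trans (bin_leq_exp _ _) _; case: (l.-1) => // j.
    by rewrite leq_exp2r // leq_subr.
  apply: leq_trans (leq_mul cdS (leqnn _)).
  apply: card_bigcup_bound => D; rewrite inE => /andP[DS /eqP cD].
  by have := card_nonrainbow_stars DS; rewrite cS cD cC ffactnn.
have := leq_mul (subset_leq_card cover) (leqnn ((k ^ k) ^ d)).
rewrite cardsT card_ffun cC => /leq_trans/(_ bound).
(* The number of colourings cancels unless it is zero, which [c0] excludes. *)
rewrite mulnA [leqRHS]mulnC leq_mul2l leqNgt lt orbF => /eqP k0.
have : 0 < k ^ #|{set T}| by rewrite expn_gt0 -cC (cardD1 c0).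
by rewrite k0.
Qed.

End Counting.

(** * Upper and lower bounds for [rx] on complete graphs *)

Lemma rx_coloring_stars (T : finType) k l (c : {set T} -> nat) :
  (forall S : {set T}, #|S| = k -> exists A : {set T},
    [/\ A \subset ~: S, l <= #|A| &
        {in A, forall v, {in S &, injective (fun s => c [set v; s])}}]) ->
  rx_coloring k l (complete [set: T]) c.
Proof.
move=> stars S _ cS; have [A [AS lA injA]] := stars S cS.
have AP i : enum_val (widen_ord lA i) \in A by apply: enum_valP.
have AN i : enum_val (widen_ord lA i) \notin S.
  by have := subsetP AS _ (AP i); rewrite inE.
exists (fun i => star (enum_val (widen_ord lA i)) S); split=> [i|i j ij].
  split.
  - rewrite /subgraph subsetT; apply/subsetP => e /edgesP[_ ce].
    by rewrite inE subsetT ce.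
  - by split; [apply: star_connected|apply: star_acyclic].
  - exact: star_rainbow (AN i) (injA _ (AP i)).
  - exact: subsetUr.
apply: stars_disjoint => // /enum_val_inj /(congr1 val) /= /val_inj.
exact: ij.
Qed.

Lemma rx_K_upper (R : realType) k l n :
  2 < k -> 0 < l -> (threshold R k l <= n%:Z)%R ->
  exists c, edge_coloring (K n) k c /\ rx_coloring k l (K n) c.
Proof.
move=> hk hl hn; have [le_n lt_n] := threshold_bound hk hl hn.
have c0 : 'I_k by apply: (@Ordinal _ 0); apply: leq_trans hk.
have [||f fP] := @exists_rainbow_stars 'I_n 'I_k c0 k l (card_ord k) hl.
- by rewrite card_ord.
- by rewrite card_ord.
exists (fun e => (f e).+1); split; first by move=> e _; rewrite /= ltn_ord.
apply: rx_coloring_stars => S cS.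
exists [set v in ~: S | injectiveb (spokes S f v)]; split; last 2 first.
- exact: fP.
- move=> v; rewrite inE => /andP[_ /injectiveP inj] s s' sS s'S.
  move=> /succn_inj /val_inj; rewrite -(spokesE f v sS) -(spokesE f v s'S).
  by move/inj => E; rewrite -(enum_rankK_in sS sS) E enum_rankK_in.
- by apply/subsetP => v; rewrite inE => /andP[].
Qed.

Lemma rx_K_lower k l n t :
  2 < k -> 0 < l -> k <= n ->
  (k %/ 2 < l \/ ramsey (k - 1) k <= n) -> t < k ->
  ~ exists c, edge_coloring (K n) t c /\ rx_coloring k l (K n) c.
Proof.
move=> hk hl le_kn alt lt_tk [c [cK rxc]].
case: alt => [lt_kl|le_rn].
  have [S _ cS] : exists2 S : {set 'I_n}, S \subset setT & #|S| = k.
    by apply: subset_of_card; rewrite cardsT card_ord.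
  have [F [FS disj]] := rxc S (subsetT _) cS.
  have ltS : t < #|S| by rewrite cS.
  (* Cancelling [k - 1] in [l (k - 1) <= k (k - 1) / 2] contradicts [k %/ 2 < l]. *)
  have := disjoint_Strees_card cK ltS FS disj; rewrite cS bin2.
  rewrite leqNgt -divn2 => /negP; apply.
  rewrite ltn_divLR // -mulnA [_ * 2]mulnC mulnA ltn_mul2r.
  by rewrite -ltnS (ltn_predK hk) (ltnW hk) /= -ltn_divLR.
(* A colouring with [t < k] colours is also one with [k - 1], so a monochromatic [k]-set exists. *)
have cK' : edge_coloring (K n) (k - 1) c.
  by move=> e /cK /andP[-> /= ct]; lia.
have [|S [cS mono]] := ramsey_prop_ge _ le_rn cK'; first by lia.
have [F [FS _]] := rxc S (subsetT _) cS.
apply: (mono_not_rainbow cK _ _ mono (FS (Ordinal hl))); by rewrite cS.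
Qed.

Local Open Scope ring_scope.

Theorem theorem2p4 (R : realType) (k l : nat) (hk : (3 <= k)%N) (hl : (1 <= l)%N) :
  ((k %/ 2 < l)%N ->
     forall n : nat, threshold R k l <= n%:Z -> rx k l (K n) = k)
  /\
  ((l <= k %/ 2)%N ->
     forall n : nat,
       Num.max (threshold R k l) (ramsey (k - 1) k)%:Z <= n%:Z ->
       rx k l (K n) = k).
Proof.
have main n : threshold R k l <= n%:Z ->
    ((k %/ 2 < l)%N \/ (ramsey (k - 1) k <= n)%N) -> rx k l (K n) = k.
  move=> hn alt; apply: least_eq; first exact: rx_K_upper hn.
  move=> t; apply: rx_K_lower => //.
  (* The threshold also guarantees [k <= n], so that [K n] has a [k]-subset at all. *)
  have [le_n _] := threshold_bound hk hl hn.
  by apply: leq_trans le_n; apply: leq_addr.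
split=> hkl n; first by move=> hn; apply: main => //; left.
by rewrite ge_max => /andP[hn hr]; apply: main => //; right.
Qed.
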